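(* Let $n,s$ be integers with $s>0$ and $n\ge 2s$. Then the maximal pairs for $(n,s)$ are exactly the following: (i) $(0,s)$ is a maximal pair for all values of $n,s$ except $n=4,\ s=2$; (ii) $(1,s-1)$ is a maximal pair for $(n,s)=(4,2)$ and for $(n,s)=(6,3)$. That is, the only maximal pair is $(0,s)$ if $(n,s)\notin\{(4,2),(6,3)\}$; the only maximal pair is $(1,1)$ if $(n,s)=(4,2)$; and the maximal pairs are $(0,3)$ and $(1,2)$ if $(n,s)=(6,3)$.
   Context: For integers $n>s>0$, a pair $(i,s-i)$ with $i$ an integer, $0\le i\le \frac{s}{2}$, is called a maximal pair if $i$ attains the maximum $\max_{0\le j\le s/2}\left\{\binom{n}{j}+\binom{n}{s-j}\right\}$ over integers $j$. *)

(* Defs.v *)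
From mathcomp Require Import all_boot.

Set Implicit Arguments.
Unset Strict Implicit.
Unset Printing Implicit Defensive.

(* Intended for 0 < s < n; the subtractions are then exact, because an index
   bounded by s./2 is at most s. *)
Definition binom_pair_sum (n s j : nat) : nat := 'C(n, j) + 'C(n, s - j).

Definition maximal_pair (n s : nat) (p : nat * nat) : Prop :=
  exists i : nat,
    [/\ i <= s./2,
        p = (i, s - i)
      & binom_pair_sum n s i = \max_(j < s./2.+1) binom_pair_sum n s j].

(* Main.v *)
Require Import Defs.
From mathcomp Require Import all_boot.
From mathcomp Require Import zify.

(** Outside the two exceptional cases, the pair [(0, s)] wins because
    [binom_pair_sum n s 0 = 1 + 'C(n, s)], whereas every pair [(a, b)] with
    [a + b = s] and [a, b > 0] satisfies ['C(n, a) + 'C(n, b) <= 'C(n, a + b)]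
    (lemma [leq_addn_bin]); the summand 1 makes the comparison strict.

    That inequality is proved by induction on [s], lowering both [n] and [s].
    If [a, b >= 2], Pascal's rule splits the left side into four terms, which
    regroup as
      [('C(n-1, a) + 'C(n-1, b-1)) + ('C(n-1, a-1) + 'C(n-1, b))];
    the lower indices of each group add up to [s - 1], so each group is at most
    ['C(n-1, s-1)].  Since [n - 1 >= 2 s - 1], ['C(n-1, s-1) <= 'C(n-1, s)],
    and Pascal's rule reassembles ['C(n, s)].  The exceptional pairs [(4, 2)]
    and [(6, 3)] never occur as [(n-1, s-1)], because [n >= 2 s] excludes
    [(5, 3)] and [(7, 4)].

    The induction bottoms out at [a = 1] or [b = 1], which is the bound
    [n + 'C(n, t) <= 'C(n, t+1)] of lemma [leq_addn_bin1]; it fails precisely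
    in the exceptional cases.  It follows from the ratio of consecutive binomial
    coefficients together with a lower bound for ['C(n, t)]. *)

Set Implicit Arguments.
Unset Strict Implicit.
Unset Printing Implicit Defensive.

(** * Growth of binomial coefficients in the lower half of a row *)

(** The ratio [(n - k) / (k + 1)] of the two coefficients is at least 1. *)
Lemma leq_bin_succ n k : k.*2 < n -> 'C(n, k) <= 'C(n, k.+1).
Proof.
move=> lt_2k_n; rewrite -(@leq_pmul2l k.+1) // mul_bin_left.
by rewrite leq_mul2r; apply/orP; right; lia.
Qed.

Lemma leq_bin_lower_half n k l : k <= l -> l.*2 <= n -> 'C(n, k) <= 'C(n, l).
Proof.
elim: l => [|l IHl]; first by rewrite leqn0 => /eqP->.
rewrite leq_eqVlt => /predU1P[-> //|le_kl] le_ln.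
by apply: leq_trans (IHl _ _) (leq_bin_succ _); lia.
Qed.

Lemma bin2_mul2 n : 2 * 'C(n, 2) = n.-1 * n.
Proof. by rewrite mul_bin_left bin1 subn1. Qed.

Lemma bin3_mul6 n : 6 * 'C(n, 3) = n.-2 * (n.-1 * n).
Proof.
rewrite -bin2_mul2 -subn2 mulnCA -mul_bin_left; lia.
Qed.

(** Multiplying by [t + 1] and using the ratio of consecutive coefficients
    turns the goal into [(t + 1) n <= (n - 2 t - 1) 'C(n, t)].  As the factor
    [n - 2 t - 1] may be as small as 1, ['C(n, t)] has to beat [(t + 1) n];
    the cubic bound ['C(n, 3)] does so from [t = 3] on. *)
Lemma leq_addn_bin1 n t :
    0 < t -> t.+1.*2 <= n -> (n, t.+1) <> (4, 2) -> (n, t.+1) <> (6, 3) ->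
  n + 'C(n, t) <= 'C(n, t.+1).
Proof.
move=> t_gt0 le_t_n ne42 ne63; rewrite -(@leq_pmul2l t.+1) // mul_bin_left.
suff main: t.+1 * n <= (n - t.*2.+1) * 'C(n, t).
  rewrite mulnDr (_ : n - t = t.+1 + (n - t.*2.+1)); last lia.
  by rewrite mulnDl addnC leq_add2l.
case: t t_gt0 le_t_n ne42 ne63 => [//|[|[|t]]] _ le_t_n ne42 ne63.
- have n_gt4 : 4 < n by case: (ltngtP 4 n) le_t_n ne42 => [||<-] //; lia.
  by rewrite bin1 leq_mul2r; apply/orP; right; lia.
- have n_gt6 : 6 < n by case: (ltngtP 6 n) le_t_n ne63 => [||<-] //; lia.
  have : 3 * n <= 'C(n, 2) by have := bin2_mul2 n; nia.
  by move/leq_trans; apply; rewrite leq_pmull //; lia.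
apply: (@leq_trans 'C(n, t.+3)); last by rewrite leq_pmull //; lia.
apply: leq_trans (@leq_bin_lower_half n 3 t.+3 _ _); try lia.
rewrite -(@leq_pmul2l 6) // bin3_mul6.
(* Here [6 (t + 4) <= 3 n], which [(n - 1) (n - 2)] dominates as [n >= 8]. *)
suff : 6 * t.+4 <= n.-2 * n.-1 by nia.
by case: n le_t_n {ne42 ne63} => [|[|n]] //= le_t_n; nia.
Qed.

(** * The superadditivity bound *)

(** Induction on [a + b]: Pascal's rule pairs the shift in [a] with the shift
    in [b], so that both groups of two terms fall under the induction
    hypothesis for the previous row. *)
Lemma leq_addn_bin n a b :
    0 < a -> 0 < b -> (a + b).*2 <= n ->
    (n, a + b) <> (4, 2) -> (n, a + b) <> (6, 3) ->
  'C(n, a) + 'C(n, b) <= 'C(n, a + b).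
Proof.
have [s def_s] : {s | a + b = s} by exists (a + b).
elim: s n a b def_s => [|s IHs] n a b def_s a_gt0 b_gt0; first lia.
rewrite def_s => le_s_n ne42 ne63.
have [a1|a_neq1] := eqVneq a 1.
  have -> : b = s by lia.
  by rewrite a1 bin1; apply: leq_addn_bin1 => //; lia.
have [b1|b_neq1] := eqVneq b 1.
  have -> : a = s by lia.
  by rewrite b1 bin1 addnC; apply: leq_addn_bin1 => //; lia.
case: n le_s_n {ne42 ne63} => [|n] le_s_n; first lia.
case: a def_s a_gt0 a_neq1 => [//|a] def_s _ a_neq1.
case: b def_s b_gt0 b_neq1 => [//|b] def_s _ b_neq1.
have IH c d : c + d = s -> 0 < c -> 0 < d -> 'C(n, c) + 'C(n, d) <= 'C(n, s).
  move=> def_cd c_gt0 d_gt0; rewrite -def_cd.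
  by apply: IHs => //; [lia | case; lia | case; lia].
have le_ab : 'C(n, a.+1) + 'C(n, b) <= 'C(n, s) by apply: IH; lia.
have le_ba : 'C(n, a) + 'C(n, b.+1) <= 'C(n, s) by apply: IH; lia.
have le_row : 'C(n, s) <= 'C(n, s.+1) by apply: leq_bin_succ; lia.
by rewrite !binS; lia.
Qed.

(** * Maximal pairs *)

Lemma maximal_pairP n s p :
  maximal_pair n s p <->
    exists i, [/\ i <= s./2, p = (i, s - i) &
      forall j, j <= s./2 -> binom_pair_sum n s j <= binom_pair_sum n s i].
Proof.
split=> -[i [le_i def_p max_i]]; exists i; split=> //.
  move=> j le_j; rewrite max_i.
  exact: (@leq_bigmax _ (fun k : 'I_s./2.+1 => binom_pair_sum n s k)
            (Ordinal (le_j : j < s./2.+1))).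
apply/eqP; rewrite eqn_leq; apply/andP; split.
  exact: (@leq_bigmax _ (fun k : 'I_s./2.+1 => binom_pair_sum n s k)
            (Ordinal (le_i : i < s./2.+1))).
by apply/bigmax_leqP => j _; apply: max_i; rewrite -ltnS.
Qed.

Lemma maximal_pair_generic n s p :
    s.*2 <= n -> (n, s) <> (4, 2) -> (n, s) <> (6, 3) ->
  maximal_pair n s p <-> p = (0, s).
Proof.
move=> le_s_n ne42 ne63.
have lt_sum i : 0 < i -> i <= s./2 -> binom_pair_sum n s i < binom_pair_sum n s 0.
  move=> i_gt0 le_i; rewrite /binom_pair_sum bin0 subn0 add1n ltnS.
  have def_s : s = i + (s - i) by lia.
  rewrite {2}def_s; apply: leq_addn_bin; rewrite -?def_s //; lia.
rewrite maximal_pairP; split=> [[[|i] [le_i -> max_i]] | ->].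
- by rewrite subn0.
- by have := max_i 0 isT; rewrite leqNgt lt_sum.
- exists 0; rewrite subn0; split=> // -[//|j] le_j.
  exact/ltnW/lt_sum.
Qed.

(** The two candidate sums are 7 at [(0, 2)] and 8 at [(1, 1)]. *)
Lemma maximal_pair_4_2 p : maximal_pair 4 2 p <-> p = (1, 1).
Proof.
rewrite maximal_pairP; split=> [[[|[|i]] [le_i -> max_i]] // | ->].
  by have := max_i 1 isT.
by exists 1; split=> // -[|[|j]].
Qed.

(** The two candidate sums, at [(0, 3)] and at [(1, 2)], both equal 21. *)
Lemma maximal_pair_6_3 p : maximal_pair 6 3 p <-> p = (0, 3) \/ p = (1, 2).
Proof.
rewrite maximal_pairP; split=> [[[|[|i]] [le_i -> max_i]] // | ].
- by left.
- by right.
- by case=> ->; [exists 0 | exists 1]; split=> // -[|[|j]].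
Qed.

Theorem proposition1p4 (n s : nat) (s_gt0 : 0 < s) (le_2s_n : 2 * s <= n) :
  (forall p : nat * nat,
     maximal_pair n s p <->
       (p = (0, s) /\ (n, s) <> (4, 2)) \/
       (p = (1, s - 1) /\ ((n, s) = (4, 2) \/ (n, s) = (6, 3)))) /\
  [/\ (n, s) <> (4, 2) -> (n, s) <> (6, 3) ->
        forall p : nat * nat, maximal_pair n s p <-> p = (0, s),
      (n, s) = (4, 2) ->
        forall p : nat * nat, maximal_pair n s p <-> p = (1, 1)
    & (n, s) = (6, 3) ->
        forall p : nat * nat, maximal_pair n s p <-> p = (0, 3) \/ p = (1, 2)].
Proof.
rewrite mul2n in le_2s_n.
split; last first.
  split=> [ne42 ne63 p | [-> ->] p | [-> ->] p].
  - exact: maximal_pair_generic.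
  - exact: maximal_pair_4_2.
  - exact: maximal_pair_6_3.
move=> p; have [[-> ->]|/eqP ne42] := eqVneq (n, s) (4, 2).
  rewrite maximal_pair_4_2; split=> [-> | [[_ []] | [-> _]]] //.
  by right; split; last left.
have [[-> ->]|/eqP ne63] := eqVneq (n, s) (6, 3).
  rewrite maximal_pair_6_3; split=> [[] -> | [[-> _] | [-> _]]]; auto.
  by left.
rewrite maximal_pair_generic //; split=> [-> | [[-> _] | [_ []]]] //.
by left.
Qed.
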